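(* (i) In every no-redundant-ownership economy, every outcome of YRMH-IGYT belongs to the strong core, and the strong core equals the rectified core. (ii) In no-redundant-ownership economies the strong core and the exclusion core do not include each other, and the strong core and the refined exclusion core do not include each other. That is, there exist no-redundant-ownership economies in which, respectively, the strong core is not a subset of the exclusion core; the strong core is not a subset of the refined exclusion core; the exclusion core is not a subset of the strong core; the refined exclusion core is not a subset of the strong core.
   Context: **Economies.** An economy is a tuple $\Gamma=(I,O,\succ_I,\{C_o\}_{o\in O})$, where $I$ is a finite set of agents, $O$ is a finite set of indivisible objects, each agent $i\in I$ demands at most one object and has a strict preference given by a linear order $\succ_i$ on $O\cup\{o^*\}$ ($o^*\notin O$ is a null object), and each object $o$ is owned by a nonempty set $C_o\subseteq I$ of agents. Write $a\succsim_i b$ if $a=b$ or $a\succ_i b$; $o$ is acceptable to $i$ if $o\succ_i o^*$. A coalition is a nonempty subset of $I$; a sub-coalition of $C$ is a nonempty proper subset of $C$. The endowments of a set of agents $C$ are $\omega(C)=\{o\in O: C_o\subseteq C\}$. **No-redundant-ownership.** An economy is no-redundant-ownership if every agent regards all objects as acceptable and $|\omega(C)|\le|C|$ for every coalition $C$. **Allocations.** An allocation is a map $\mu:I\to O\cup\{o^*\}$ such that each $o\in O$ is assigned to at most one agent ($|\mu^{-1}(o)|\le 1$); any number of agents may be assigned $o^*$. For a coalition $C$, $\mu(C)=\{\mu(i):i\in C\}$. **Self-enforcing.** A coalition $C$ is self-enforcing in an allocation $\sigma$ if $\sigma(C)\subseteq\omega(C)\cup\{o^*\}$; it is minimal self-enforcing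 in $\sigma$ if it is self-enforcing in $\sigma$ and no sub-coalition of $C$ is self-enforcing in $\sigma$. Let $C_{\sigma=\mu}=\{i\in C:\sigma(i)=\mu(i)\}$. **Strong core.** $\mu$ is weakly blocked by a coalition $C$ via another allocation $\sigma$ if (1) $\sigma(i)\succsim_i\mu(i)$ for all $i\in C$, and $\sigma(j)\succ_j\mu(j)$ for some $j\in C$; (2) $\sigma(C)\subseteq\omega(C)\cup\{o^*\}$. The strong core is the set of allocations that are not weakly blocked. **Rectified core.** $\mu$ is rectification blocked by $C$ via $\sigma$ if $\mu$ is weakly blocked by $C$ via $\sigma$ and (3) for every coalition $C'\subseteq C_{\sigma=\mu}$ that is self-enforcing in $\sigma$ and every $i\in C\setminus C'$: $\sigma(i)\in\omega(C')$ implies $\sigma(i)\notin\mu(I\setminus C)$. The rectified core is the set of allocations that are not rectification blocked. **Exclusion core.** For a coalition $C$ and an allocation $\mu$, let $C^0=C$, $C^k=C^{k-1}\cup\{i\in I:\mu(i)\in\omega(C^{k-1})\}$ for $k\ge1$, and $\Omega(C|\omega,\mu)=\omega\big(\bigcup_{k=0}^\infty C^k\big)$. $\mu$ is exclusion blocked by a coalition $C$ via another allocation $\sigma$ if (1) $\sigma(i)\succ_i\mu(i)$ for all $i\in C$; (2) for every $j\in I$, $\mu(j)\succ_j\sigma(j)$ implies $\mu(j)\in\Omega(C|\omega,\mu)$. The exclusion core is the set of allocations that are not exclusion blocked. **Refined exclusion core.** $\mu$ is refined exclusion blocked by a coalition $C$ via another allocation $\sigma$ if: (1) $\sigma(i)\succsim_i\mu(i)$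 for all $i\in C$, and $\sigma(j)\succ_j\mu(j)$ for some $j\in C$; (2) for every $j\in I$, $\mu(j)\succ_j\sigma(j)$ implies $\mu(j)\in\Omega(C|\omega,\mu)$; (3) if $C_{\sigma=\mu}\ne\emptyset$, then at least one of the following holds: (a) $C_{\sigma=\mu}$ is self-enforcing in $\sigma$ and, for every $j\in I$, $\mu(j)\succ_j\sigma(j)$ implies $\mu(j)\notin\Omega(C_{\sigma=\mu}|\omega,\mu)$; (b) $C$ is minimal self-enforcing in $\sigma$. The refined exclusion core is the set of allocations that are not refined exclusion blocked. **YRMH-IGYT algorithm.** Fix a linear order $\rhd$ of agents (fixed throughout). A ''current order'' of remaining agents is initialized as $\rhd$ and is updated by the algorithm. Initially every object points to its $\rhd$-highest owner. After step $t$, let $I(t)$ be the set of remaining agents, $O(t)$ the set of remaining objects, $C_o(t)$ the set of remaining owners of $o\in O(t)$, and $S_o(t)$ the set of remaining agents who have obtained shared ownership of $o\in O(t)$; $I(0)=I$, $O(0)=O$, $C_o(0)=C_o$, $S_o(0)=\emptyset$. The null object $o^*$ is always available. Step $t\ge1$ (while agents remain): maintain the arcs between remaining agents and objects from the previous step. If the agent pointed to by an object $o\in O(t-1)$ was removed in the previous step, then: if $C_o(t-1)\neq\emptyset$, $o$ now points to the $\rhd$-highest agent in $C_o(t-1)$; if $C_o(t-1)=\emptyset$ and $S_o(t-1)\ne\emptyset$, $o$ points to the $\rhd$-highest agent in $S_o(t-1)$; if both are empty, $o$ points to no agent. Then let the highest-ranked agent $i$ in the current order point to her favorite object $o$ among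 the remaining objects (including $o^*$). - If $o$ points to no agent, or $o=o^*$, then $i$ obtains $o$ and they are removed. - If $o$ points to an agent and a cycle forms, every agent in the cycle obtains the object she points to, and the agents and objects in the cycle are removed. Moreover, for every agent $j$ in the cycle and every remaining object $a$ with $j\in C_a(t-1)\cup S_a(t-1)$, and for every object $b$ in the cycle and every remaining agent $j'\in C_b(t-1)\cup S_b(t-1)$: if $j'\notin C_a(t-1)\cup S_a(t-1)$, then $j'$ obtains shared ownership of $a$ in following steps (is added to $S_a$). - If $o$ points to an agent but no cycle forms, the agent pointed to by $o$ is moved to the top of the current order. The algorithm stops when all agents are removed. The outcomes of YRMH-IGYT are the allocations it produces as $\rhd$ ranges over all linear orders of agents. *)

(* Defs.v *)
From mathcomp Require Import all_boot.
Set Implicit Arguments.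
Unset Strict Implicit.
Unset Printing Implicit Defensive.

Definition strict_linear_order (T : Type) (R : rel T) : Prop :=
  [/\ irreflexive R, transitive R & forall x y, x <> y -> R x y || R y x].

(* [None : option O] is the null object and [pref i a b] reads
   "agent [i] strictly prefers [a] to [b]". *)
Record economy (I O : finType) := Economy {
  pref : I -> rel (option O);
  owners : O -> {set I};
  pref_linear : forall i, strict_linear_order (pref i);
  owners_neq0 : forall o, owners o != set0
}.

Section Cores.
Variables (I O : finType) (E : economy I O).
Implicit Types (C D : {set I}) (mu sigma : {ffun I -> option O}).

Definition wpref (i : I) (a b : option O) : bool := (a == b) || pref E i a b.

(* Sets of endowments are sets of non-null elements of [option O], so that
   they can be compared directly with images of allocations. *)
Definition endow C : {set option O} :=
  [set a | if a is Some o then owners E o \subset C else false].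

Definition no_redundant_ownership : Prop :=
  (forall i o, pref E i (Some o) None) /\
  (forall C, C != set0 -> #|endow C| <= #|C|).

Definition allocation mu : Prop :=
  forall o, #|[set i | mu i == Some o]| <= 1.

Definition self_enforcing sigma C : Prop :=
  sigma @: C \subset endow C :|: [set None].

Definition minimal_self_enforcing sigma C : Prop :=
  self_enforcing sigma C /\
  forall D, D != set0 -> D \proper C -> ~ self_enforcing sigma D.

Definition agree C sigma mu : {set I} := [set i in C | sigma i == mu i].

Definition weak_improvement mu C sigma : Prop :=
  (forall i, i \in C -> wpref i (sigma i) (mu i)) /\
  (exists2 j, j \in C & pref E j (sigma j) (mu j)).

Definition weakly_blocked mu C sigma : Prop :=
  [/\ C != set0, allocation sigma, sigma <> mu,
      weak_improvement mu C sigma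
    & sigma @: C \subset endow C :|: [set None]].

Definition strong_core mu : Prop :=
  allocation mu /\ ~ exists C sigma, weakly_blocked mu C sigma.

Definition rectification_blocked mu C sigma : Prop :=
  weakly_blocked mu C sigma /\
  forall D, D != set0 -> D \subset agree C sigma mu -> self_enforcing sigma D ->
  forall i, i \in C :\: D ->
    sigma i \in endow D -> sigma i \notin mu @: (~: C).

Definition rectified_core mu : Prop :=
  allocation mu /\ ~ exists C sigma, rectification_blocked mu C sigma.

Definition dependents mu C (k : nat) : {set I} :=
  iter k (fun D => D :|: [set i | mu i \in endow D]) C.

(* [a] belongs to the endowments of the union over all [k] of
   [dependents mu C k]. *)
Definition extended_endow mu C (a : option O) : Prop :=
  if a is Some o
  then forall i, i \in owners E o -> exists k, i \in dependents mu C k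
  else False.

Definition exclusion_blocked mu C sigma : Prop :=
  [/\ C != set0, allocation sigma, sigma <> mu,
      forall i, i \in C -> pref E i (sigma i) (mu i)
    & forall j, pref E j (mu j) (sigma j) -> extended_endow mu C (mu j)].

Definition exclusion_core mu : Prop :=
  allocation mu /\ ~ exists C sigma, exclusion_blocked mu C sigma.

Definition refined_exclusion_blocked mu C sigma : Prop :=
  [/\ [/\ C != set0, allocation sigma & sigma <> mu],
      weak_improvement mu C sigma,
      forall j, pref E j (mu j) (sigma j) -> extended_endow mu C (mu j)
    & agree C sigma mu <> set0 ->
      (self_enforcing sigma (agree C sigma mu) /\
       forall j, pref E j (mu j) (sigma j) ->
         ~ extended_endow mu (agree C sigma mu) (mu j))
      \/ minimal_self_enforcing sigma C].

Definition refined_exclusion_core mu : Prop :=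
  allocation mu /\ ~ exists C sigma, refined_exclusion_blocked mu C sigma.

End Cores.

Section YRMH_IGYT.
Variables (I O : finType) (E : economy I O) (rank : rel I).

(* [cur_order] lists the remaining agents, highest first.  [agent_arc i = None]
   means that [i] has no maintained arc (an agent pointing to the null object
   leaves at once, so maintained arcs always end at objects in [O]).
   [shared] records the shared ownerships obtained so far, removed agents
   included; it is always used through [rem_shared].  Values of [object_arc]
   and [shared] at removed objects, of [agent_arc] at removed agents, and of
   [outcome] at remaining agents are irrelevant. *)
Record state := State {
  cur_order : seq I;
  rem_objects : {set O};
  object_arc : O -> option I;
  agent_arc : I -> option O;
  shared : O -> {set I};
  outcome : {ffun I -> option O}
}.

Definition rem_agents (s : state) : {set I} := [set i in cur_order s].
Definition rem_owners (s : state) (o : O) : {set I} :=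
  owners E o :&: rem_agents s.
Definition rem_shared (s : state) (o : O) : {set I} :=
  shared s o :&: rem_agents s.

Definition highest (A : {set I}) : option I :=
  [pick i in A | [forall j in A, (i == j) || rank i j]].

(* The maximum always exists, so the default value is never used. *)
Definition favorite (s : state) (i : I) : option O :=
  let available := [set a | if a is Some o then o \in rem_objects s else true] in
  odflt None
    [pick a in available | [forall b in available, wpref E i a b]].

Definition init : state := {|
  cur_order := sort (fun i j => (i == j) || rank i j) (enum I);
  rem_objects := setT;
  object_arc := fun o => highest (owners E o);
  agent_arc := fun=> None;
  shared := fun=> set0;
  outcome := [ffun=> None]
|}.

Definition updated_object_arc (s : state) (o : O) : option I :=
  if object_arc s o is Some j then
    if j \in rem_agents s then Some j
    else if rem_owners s o != set0 then highest (rem_owners s o)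
    else if rem_shared s o != set0 then highest (rem_shared s o)
    else None
  else None.

(* The arcs of agents once [i] points to her favorite object [a], if not null. *)
Definition updated_agent_arc (s : state) (i : I) (a : option O) (k : I)
    : option O :=
  if k == i then a
  else if agent_arc s k is Some o then
    if o \in rem_objects s then Some o else None
  else None.

Definition step (s : state) : state :=
  if cur_order s is i :: rest then
    let oarc := updated_object_arc s in
    let a := favorite s i in
    let aarc := updated_agent_arc s i a in
    let leave_with_favorite := {|
      cur_order := rest;
      rem_objects := [set o in rem_objects s | Some o != a];
      object_arc := oarc;
      agent_arc := aarc;
      shared := shared s;
      outcome := [ffun k => if k == i then a else outcome s k]
    |} in
    if obind oarc a is Some j then
      (* [k] points to an object that points to [l]. *)
      let arc : rel I := fun k l => obind oarc (aarc k) == Some l in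
      if connect arc j i then
        let cycle_agents := [set k | connect arc i k && connect arc k i] in
        let cycle_objects := [set o | [exists k in cycle_agents,
                                         aarc k == Some o]] in
        let cowners o := rem_owners s o :|: rem_shared s o in
        let order' := [seq k <- cur_order s | k \notin cycle_agents] in
        let objects' := rem_objects s :\: cycle_objects in
        {| cur_order := order';
           rem_objects := objects';
           object_arc := oarc;
           agent_arc := aarc;
           shared := fun o =>
             if o \in objects' then
               shared s o :|:
                 [set l in order' | (l \notin cowners o) &&
                   [exists k in cycle_agents, (k \in cowners o) &&
                     [exists b in cycle_objects, l \in cowners b]]]
             else shared s o;
           outcome := [ffun k => if k \in cycle_agents then aarc k
                                 else outcome s k] |}
      else
        {| cur_order := j :: rem j (cur_order s);
           rem_objects := rem_objects s;
           object_arc := oarc;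
           agent_arc := aarc;
           shared := shared s;
           outcome := outcome s |}
    else leave_with_favorite
  else s.

End YRMH_IGYT.

Arguments step : simpl never.

(* The run from every [rank] is finite, so every linear order of agents
   yields an outcome. *)
Section Termination.
Variables (I O : finType) (E : economy I O) (rank : rel I).
Local Notation step := (step E rank).

Lemma favorite_rem (s : state I O) i o :
  favorite E s i = Some o -> o \in rem_objects s.
Proof.
rewrite /favorite; case: pickP => [b /andP[b_av _]|//] /= b_eq.
by move: b_av; rewrite b_eq inE.
Qed.

Lemma updated_object_arc_rem (s : state I O) o j :
  updated_object_arc E rank s o = Some j -> j \in rem_agents s.
Proof.
have high A : highest rank (A :&: rem_agents s) = Some j -> j \in rem_agents s.
  by rewrite /highest; case: pickP => // k /andP[/setIP[_ ?] _] [<-].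
rewrite /updated_object_arc; case: (object_arc s o) => // k.
case: ifP => [k_in [<-] //|_]; case: ifP => _; first exact: high.
by case: ifP => // _; exact: high.
Qed.

Let link (s : state I O) : rel I := fun x y =>
  [exists o in rem_objects s, (agent_arc s y == Some o) &&
                              (object_arc s o == Some x)].

Lemma step_shrinks (n : nat) (s : state I O) i p q :
    uniq (cur_order s) -> cur_order s = i :: p ++ q -> size q < n ->
    path (link s) i p ->
  exists2 t, uniq (cur_order (iter t step s))
           & size (cur_order (iter t step s)) < size (cur_order s).
Proof.
elim: n s i p q => // n IHn s i p q s_uniq s_eq; rewrite ltnS => q_n p_path.
pose oarc := updated_object_arc E rank s; pose a := favorite E s i.
pose aarc := updated_agent_arc s i a.
pose arc : rel I := fun k l => obind oarc (aarc k) == Some l.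
have [s' s'E] : exists s', s' = step s by exists (step s).
have := s'E; rewrite /Defs.step {1}s_eq /= -/a -/oarc -/aarc -/arc in s'E => s'S.
rewrite {}s'S in s'E; move: s'E.
case a_j: (obind oarc a) => [j|]; last first.
  move=> st; exists 1; rewrite /= st /= ?s_eq //= ?ltnS //.
  by move: s_uniq; rewrite s_eq => /andP[].
case: ifP => [ji|nji] st.
  exists 1; rewrite /= st /=; first exact: filter_uniq.
  rewrite size_filter -(count_predC (mem [set k | connect arc i k && connect arc k i]) (cur_order s)).
  rewrite -[X in X < _]add0n ltn_add2r -has_count; apply/hasP; exists i.
    by rewrite s_eq mem_head.
  by rewrite /= inE !connect0.
case a_o: a a_j => [o|//] /= o_j.
have o_rem := favorite_rem a_o.
have j_rem := updated_object_arc_rem o_j.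
have inp x : x \in i :: p -> x \in rem_agents s.
  by rewrite [in X in _ -> X]inE s_eq -cat_cons mem_cat => ->.
have ip : i \notin p.
  by move: s_uniq; rewrite s_eq /= mem_cat negb_or => /andP[/andP[]].
have linkP x y : x \in i :: p -> y \in p -> link s x y ->
    exists b, [/\ b \in rem_objects s, aarc y = Some b & oarc b = Some x].
  move=> x_in y_in /existsP[b /and3P[b_rem /eqP b_a /eqP b_o]].
  exists b; split => //; rewrite /aarc /updated_agent_arc /oarc.
    by rewrite ifN ?b_a ?b_rem //; apply: contraNneq ip => <-.
  by rewrite /updated_object_arc b_o inp.
have j_p : j \notin i :: p.
  apply: contraFN nji => /(nthP i)[m m_p <-] {j o_j j_rem st}.
  elim: m m_p => [_|m IHm m_p] /=; first exact: connect0.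
  have m_p' : m < size (i :: p) by exact: ltnW.
  have [b [_ b_a b_o]] := linkP _ _ (mem_nth i m_p') (mem_nth i (m_p : m < size p))
                                (pathP i p_path m m_p).
  by apply: connect_trans (IHm m_p'); apply: connect1; rewrite /arc b_a /= b_o.
have j_q : j \in q.
  by move: j_rem; rewrite inE s_eq -cat_cons mem_cat (negPf j_p).
have st_eq : cur_order (step s) = j :: (i :: p) ++ rem j q.
  rewrite st [cur_order _]/= s_eq -cat_cons; congr (_ :: _).
  elim: (i :: p) j_p => //= x r IHr; rewrite inE negb_or => /andP[jx /IHr ->].
  by rewrite eq_sym (negPf jx).
have size_q : (size (rem j q)).+1 = size q.
  by rewrite size_rem // prednK //; case: (q) j_q.
have size_st : size (cur_order (step s)) = size (cur_order s).
  by rewrite st_eq s_eq /= !size_cat -size_q addnS.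
have [||||t t_uniq t_lt] := IHn (step s) j (i :: p) (rem j q).
- rewrite st /= mem_rem_uniq // rem_uniq // inE eqxx //=.
- by rewrite st_eq.
- by rewrite size_q.
- rewrite /= {1}/link st /=; apply/andP; split.
    by apply/existsP; exists o; rewrite /= o_rem /aarc /updated_agent_arc eqxx
      a_o -/oarc o_j !eqxx.
  apply/(pathP i) => m m_p.
  have m_p' : m < size (i :: p) by exact: ltnW.
  have [b [b_rem b_a b_o]] := linkP _ _ (mem_nth i m_p') (mem_nth i (m_p : m < size p))
                                    (pathP i p_path m m_p).
  by apply/existsP; exists b; rewrite /= b_rem /= b_a b_o !eqxx.
by exists t.+1; rewrite iterSr // -size_st.
Qed.

Theorem yrmh_igyt_terminates :
  exists t, cur_order (iter t step (init E rank)) = [::].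
Proof.
have : uniq (cur_order (init E rank)) by rewrite sort_uniq enum_uniq.
have [n] := ubnP (size (cur_order (init E rank))).
elim: n (init E rank) => // n IHn s; rewrite ltnS => s_n s_uniq.
case s_eq: (cur_order s) => [|i p]; first by exists 0.
have [t t_uniq t_lt] := @step_shrinks _ s i [::] p s_uniq s_eq (ltnSn _) isT.
have [t' t'_nil] := IHn _ (leq_trans t_lt s_n) t_uniq.
by exists (t' + t); rewrite iterD.
Qed.

End Termination.

Definition yrmh_igyt_outcome (I O : finType) (E : economy I O)
    (mu : {ffun I -> option O}) : Prop :=
  exists2 rank : rel I, strict_linear_order rank &
  exists t : nat,
    let s := iter t (step E rank) (init E rank) in
    cur_order s = [::] /\ mu = outcome s.

(* Main.v *)
(** In a weak block [C] via [sigma] violating condition (3), the witness [D]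
    leaves an object of [endow D] unused inside [D]; as [|endow D| <= |D|], some
    member of [D] is assigned the null object and can be given that object, so
    [D] is a strictly smaller weakly blocking coalition.  Hence a minimal weakly
    blocking coalition is rectification blocking.

    For YRMH-IGYT, shared ownership is passed on exactly so that an object whose
    owners and sharers have all departed would come with a self-enforcing set of
    departed agents owning more objects than it has members.  So every remaining
    object points to a (shared) owner and agents leave in trading cycles until
    no object remains.  If [C] weakly blocks the outcome via [sigma], then by
    induction on the run the objects of [endow C] point into [C], a cycle meeting
    [C] stays inside [C], and its members, who get their favorite remaining
    objects, get exactly their assignments under [sigma]; so nobody in [C]
    improves. *)
Require Import Defs.
From mathcomp Require Import all_boot.
Set Implicit Arguments.
Unset Strict Implicit.
Unset Printing Implicit Defensive.

(** * Linear orders, allocations and self-enforcing coalitions *)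

(** An element of [A] with the fewest elements of [A] above it works: if some [y] in [A] were above
    it, then by transitivity [y] would have strictly fewer. *)
Lemma linear_max (T : finType) (R : rel T) (A : {set T}) (x0 : T) :
    strict_linear_order R -> x0 \in A ->
  exists2 x, x \in A & forall y, y \in A -> (x == y) || R x y.
Proof.
move=> [Rirr Rtr Rtot] x0A.
case: (arg_minnP (fun x => #|[set y in A | R y x]|) x0A) => x xA xmin.
exists x => // y yA; have [//|/eqP xy] := eqVneq x y.
have /orP[->|Ryx] := Rtot _ _ xy; first by rewrite orbT.
have := xmin _ yA; rewrite leqNgt => /negP[]; apply: proper_card.
apply/properP; split.
  apply/subsetP => z; rewrite !inE => /andP[-> zy].
  exact: Rtr zy Ryx.
by exists y; rewrite !inE yA ?Ryx ?Rirr.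
Qed.

Lemma allocationP (I O : finType) (mu : {ffun I -> option O}) :
  allocation mu <->
  forall i j o, mu i = Some o -> mu j = Some o -> i = j.
Proof.
split=> [mu_al i j o i_o j_o | mu_inj o].
  have /card_le1_eqP := mu_al o.
  by apply; rewrite inE ?i_o ?j_o.
by apply/card_le1_eqP => i j; rewrite !inE => /eqP i_o /eqP /mu_inj; exact.
Qed.

Section Preferences.
Variables (I O : finType) (E : economy I O).
Implicit Types (C D A : {set I}) (mu sigma : {ffun I -> option O}).

Lemma prefxx i : irreflexive (pref E i).
Proof. by have [] := pref_linear E i. Qed.

Lemma wpref_anti i : antisymmetric (wpref E i).
Proof.
have [irr tr _] := pref_linear E i.
move=> a b; rewrite /wpref => /andP[/orP[/eqP//|ab] /orP[/eqP->//|ba]].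
by have := tr _ _ _ ab ba; rewrite irr.
Qed.

Lemma wpref_pref i a b : wpref E i a b -> pref E i b a = false.
Proof.
move=> ab; apply/negP => ba.
have eq_ab : a = b by apply: (@wpref_anti i); rewrite ab /wpref ba orbT.
by rewrite eq_ab prefxx in ba.
Qed.

Lemma mem_endow C o : (Some o \in endow E C) = (owners E o \subset C).
Proof. by rewrite inE. Qed.

Lemma self_enforcingP sigma C :
  reflect (forall i o, i \in C -> sigma i = Some o -> owners E o \subset C)
          (sigma @: C \subset endow E C :|: [set None]).
Proof.
apply: (iffP subsetP) => [sC i o iC i_o | sC _ /imsetP[i iC ->]].
  by have := sC _ (imset_f sigma iC); rewrite i_o !inE orbF.
by rewrite !inE; case i_o: (sigma i) => [o|//]; rewrite (sC i).
Qed.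

End Preferences.

(** * The strong core coincides with the rectified core *)

Section NoRedundantOwnership.
Variables (I O : finType) (E : economy I O).
Hypothesis nro : no_redundant_ownership E.
Implicit Types (C D A : {set I}) (mu sigma : {ffun I -> option O}).

(** If every member of [C] held an object, [sigma] would inject [C] into the endowments other than
    [o], so [C] would own more objects than it has members. *)
Lemma self_enforcing_slack sigma C o :
    allocation sigma -> C != set0 -> self_enforcing E sigma C ->
    Some o \in endow E C -> (forall i, i \in C -> sigma i <> Some o) ->
  exists2 d, d \in C & sigma d = None.
Proof.
move=> /allocationP s_al C0 C_self oC o_free.
have [/existsP[d /andP[dC /eqP dN]]|noN] :=
  boolP [exists d, (d \in C) && (sigma d == None)]; first by exists d.
have some i : i \in C -> exists p, sigma i = Some p.
  move=> iC; case i_p: (sigma i) => [p|]; first by exists p.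
  by case/existsP: noN; exists i; rewrite iC i_p eqxx.
have := nro.2 _ C0; rewrite (cardsD1 (Some o)) oC.
rewrite leqNgt => /negP[]; rewrite ltnS.
have <- : #|sigma @: C| = #|C|.
  apply: card_in_imset => i j iC _; have [p i_p] := some _ iC.
  by rewrite i_p => j_p; apply: (s_al i j p).
apply/subset_leq_card/subsetP => x x_s; have := subsetP C_self _ x_s.
case/imsetP: x_s => i iC ->; have [p i_p] := some _ iC.
rewrite in_setU in_setD1 in_set1 i_p orbF => ->; rewrite andbT -i_p.
exact/eqP/o_free.
Qed.

Lemma weakly_blocked_rectification mu C sigma :
    weakly_blocked E mu C sigma ->
  exists D tau, rectification_blocked E mu D tau.
Proof.
have [n] := ubnP #|C|; elim: n C sigma => // n IHn C sigma; rewrite ltnS => C_n bl.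
(* Failure of condition (3), as a boolean so that a case split is possible. *)
pose viol D i := [&& D != set0, D \subset agree C sigma mu,
   sigma @: D \subset endow E D :|: [set None], i \in C :\: D,
   sigma i \in endow E D & sigma i \in mu @: (~: C)].
have [/existsP[D /existsP[i /and5P[D0 D_agree D_self iCD /andP[iD i_mu]]]]|nviol] :=
  boolP [exists D, exists i, viol D i]; last first.
  exists C, sigma; split=> // D D0 D_agree D_self i iCD iD; apply/negP => i_mu.
  by case/existsP: nviol; exists D; apply/existsP; exists i; apply/and5P; split=> //; rewrite iD.
have [C0 s_al s_mu [s_wk _] C_self] := bl.
have /setDP[iC niD] := iCD.
case i_o: (sigma i) iD => [o|]; last by rewrite inE.
move=> oD; have s_inj := (allocationP _).1 s_al.
have [d dD dN] : exists2 d, d \in D & sigma d = None.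
  apply: (self_enforcing_slack s_al D0 D_self oD) => k kD k_o.
  by move: niD; rewrite -(s_inj _ _ _ k_o i_o) kD.
have agreeP k : k \in D -> k \in C /\ sigma k = mu k.
  by move=> /(subsetP D_agree); rewrite inE => /andP[? /eqP].
(* As [d] lies in the agreement set, [mu d = None], so receiving [o] improves [d]. Agents outside
   [D] get the null object, which frees [o] from [i]. *)
pose tau : {ffun I -> option O} :=
  [ffun k => if k == d then Some o else if k \in D then sigma k else None].
have tau_d : tau d = Some o by rewrite ffunE eqxx.
have mu_d : mu d = None by rewrite -(agreeP _ dD).2.
apply: (IHn D tau).
  apply: leq_trans C_n; apply: proper_card; apply/properP; split.
    by apply/subsetP => k /agreeP[].
  by exists i.
split=> //.
- apply/allocationP => k l p; rewrite !ffunE.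
  have out m : m \in D -> sigma m <> Some o.
    by move=> mD m_o; move: niD; rewrite -(s_inj _ _ _ m_o i_o) mD.
  case: eqP => [->|_]; case: eqP => [->|_] //.
  + by move=> <-; case: ifP => // /out.
  + by case: ifP => // /out k_o k_p [p_o]; move: k_p; rewrite -p_o.
  by case: ifP => // _; case: ifP => // _; exact: s_inj.
- by move=> tau_mu; move: tau_d; rewrite tau_mu mu_d.
- split; last by exists d; rewrite ?tau_d ?mu_d //; exact: nro.1.
  move=> k kD; rewrite ffunE; case: eqP => [->|_].
    by rewrite mu_d /wpref nro.1 orbT.
  by rewrite kD /wpref (agreeP _ kD).2 eqxx.
apply/self_enforcingP => k p kD; rewrite ffunE; case: eqP => [_ [<-]|_].
  by rewrite -mem_endow.
by rewrite kD => /(self_enforcingP E sigma D D_self _ _ kD).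
Qed.

Lemma strong_core_rectified mu : strong_core E mu <-> rectified_core E mu.
Proof.
split=> -[mu_al nbl]; split=> // -[C [sigma bl]]; apply: nbl.
  by exists C, sigma; case: bl.
exact: weakly_blocked_rectification bl.
Qed.

End NoRedundantOwnership.

(** * Invariants of a run of YRMH-IGYT *)

Section Algorithm.
Variables (I O : finType) (E : economy I O) (rank : rel I).
Hypothesis nro : no_redundant_ownership E.
Hypothesis rank_linear : strict_linear_order rank.
Implicit Types (s : state I O) (A G K : {set I}).

Local Notation step := (Defs.step E rank).
Local Notation oarc s := (updated_object_arc E rank s).

Definition coowners s o : {set I} := rem_owners E s o :|: rem_shared s o.

Definition available s : {set option O} :=
  [set a | if a is Some o then o \in rem_objects s else true].

Lemma mem_coowners s o k :
  (k \in coowners s o) = ((k \in owners E o) || (k \in shared s o)) &&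
                         (k \in rem_agents s).
Proof. by rewrite !inE andb_orl. Qed.

Lemma highest_neq0 A : A != set0 -> exists2 j, highest rank A = Some j & j \in A.
Proof.
case/set0Pn => i iA; rewrite /highest; case: pickP => [j /andP[jA _]|none].
  by exists j.
have [j jA jmax] := linear_max rank_linear iA.
by have := none j; rewrite /= jA /= => /forall_inP[].
Qed.

Lemma favorite_max s i b : b \in available s -> wpref E i (favorite E s i) b.
Proof.
rewrite /favorite -/(available s) => bA.
case: pickP => [a /andP[_ /forall_inP amax]|none] /=; first exact: amax.
have [a aA amax] := linear_max (pref_linear E i) bA.
by have := none a; rewrite aA /= => /forall_inP[].
Qed.

Lemma favorite_None s i : favorite E s i = None -> rem_objects s = set0.
Proof.
move=> fN; apply/setP => o; rewrite in_set0; apply/negP => o_rem.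
have: wpref E i None (Some o) by rewrite -fN favorite_max // inE.
by move=> /wpref_pref; rewrite nro.1.
Qed.

(* The set [G] certifies that every agent reached from [o] by passing from
   objects to owners and from departed agents to their assignments has either
   departed or is a current (shared) owner of [o].  This is what the transfer
   of shared ownership maintains. *)
Definition departed_closure s o G : Prop :=
  [/\ [disjoint G & rem_agents s], owners E o \subset G :|: coowners s o
    & forall d p, d \in G -> outcome s d = Some p ->
        owners E p \subset G :|: coowners s o].

(** Maintained arcs stay optimal because the available set only shrinks. [inv_object_arc] is
    conditional because an object is redirected only in the step after its target leaves.
    [inv_departed] reflects that nobody prefers the null object while an object remains.
    [inv_closure] keeps the co-owners of a remaining object from running out. *)
Record invariant s : Prop := Invariant {
  inv_uniq : uniq (cur_order s);
  inv_agent_arc : forall k o b, agent_arc s k = Some o ->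
    o \in rem_objects s -> b \in available s -> wpref E k (Some o) b;
  inv_object_arc : forall o, o \in rem_objects s ->
    exists2 j, object_arc s o = Some j
             & j \in rem_agents s -> j \in coowners s o;
  inv_outcome : forall k o, outcome s k = Some o ->
    o \notin rem_objects s /\ k \notin rem_agents s;
  inv_outcome_inj : forall k l o,
    outcome s k = Some o -> outcome s l = Some o -> k = l;
  inv_departed : forall o k, o \in rem_objects s -> k \notin rem_agents s ->
    outcome s k <> None;
  inv_closure : forall o, o \in rem_objects s -> exists G, departed_closure s o G
}.

Lemma mem_rem_init k : k \in rem_agents (init E rank).
Proof. by rewrite inE mem_sort mem_enum. Qed.

Lemma invariant_init : invariant (init E rank).
Proof.
split=> //=.
- by rewrite sort_uniq enum_uniq.
- move=> o _; have [j j_o jE] := highest_neq0 (owners_neq0 E o).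
  by exists j => // _; rewrite mem_coowners jE mem_rem_init.
- by move=> k o; rewrite ffunE.
- by move=> k l o; rewrite ffunE.
- by move=> o k _; rewrite mem_rem_init.
move=> o _; exists set0; split=> [| |d p]; last by rewrite inE.
  by apply/pred0P => k; rewrite /= inE.
by apply/subsetP => k kE; rewrite inE mem_coowners kE mem_rem_init orbT.
Qed.

(** Without co-owners the certificate [G] is self-enforcing in the current outcome and owns the
    unassigned [o]. By slack some departed agent of [G] then has the null object, which cannot
    happen while [o] remains. *)
Lemma coowners_neq0 s o : invariant s -> o \in rem_objects s -> coowners s o != set0.
Proof.
move=> inv o_rem; apply/eqP => co0.
have [G [G_dep]] := inv_closure inv o_rem; rewrite co0 setU0 => oG G_closed.
have dep k : k \in G -> k \notin rem_agents s.
  by move=> kG; have /pred0P/(_ k)/= := G_dep; rewrite kG /= => ->.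
pose mu : {ffun I -> option O} := outcome s.
have [d dG dN] : exists2 d, d \in G & mu d = None.
  apply: (self_enforcing_slack nro (o := o)).
  - by apply/allocationP; exact: inv_outcome_inj.
  - by have [i iE] := set0Pn _ (owners_neq0 E o); apply/set0Pn; exists i; exact: (subsetP oG).
  - by apply/self_enforcingP => i p iG i_p; exact: G_closed iG i_p.
  - by rewrite mem_endow.
  by move=> i _ i_o; have [] := inv_outcome inv i_o; rewrite o_rem.
exact: (inv_departed inv o_rem (dep _ dG) dN).
Qed.

Lemma updated_object_arc_coowner s o :
    invariant s -> o \in rem_objects s ->
  exists2 j, oarc s o = Some j & j \in coowners s o.
Proof.
move=> inv o_rem; have [j j_o jE] := inv_object_arc inv o_rem.
rewrite /updated_object_arc j_o; case: ifP => [/jE ?|_]; first by exists j.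
case: ifP => [/highest_neq0[l -> l_in]|/negbFE/eqP own0].
  by exists l => //; rewrite inE l_in.
have := coowners_neq0 inv o_rem; rewrite /coowners own0 set0U => sh0.
by rewrite sh0; have [l -> l_in] := highest_neq0 sh0; exists l.
Qed.

(* The last clause of [StepCycle] says that [K] is a single trading cycle. *)
Variant step_spec s (s' : state I O) : Prop :=
| StepNull i of rem_objects s = set0 & rem_objects s' = set0
    & i \in rem_agents s & rem_agents s' = rem_agents s :\ i
    & outcome s' = [ffun k => if k == i then None else outcome s k]
| StepMove of rem_objects s' = rem_objects s & rem_agents s' = rem_agents s
    & shared s' = shared s & outcome s' = outcome s
| StepCycle K (f : I -> option O) of
    rem_objects s' = [set o in rem_objects s | Some o \notin f @: K]
    & rem_agents s' = rem_agents s :\: K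
    & outcome s' = [ffun k => if k \in K then f k else outcome s k]
    & (forall o l, o \in rem_objects s' -> l \in rem_agents s' ->
        l \in coowners s' o <->
        l \in coowners s o \/ exists k k' p,
          [/\ k \in K, k \in coowners s o, k' \in K, f k' = Some p
            & l \in coowners s p])
    & K \subset rem_agents s
    & (forall k, k \in K -> exists o l,
        [/\ f k = Some o, o \in rem_objects s, l \in K & l \in coowners s o])
    & {in K &, injective f}
    & (forall k b, k \in K -> b \in available s -> wpref E k (f k) b)
    & (forall A, (forall k o, k \in K -> k \in A -> f k = Some o ->
                    coowners s o \subset A) ->
        forall k, k \in K -> k \in A -> K \subset A).

Lemma coowners_rem s o : coowners s o \subset rem_agents s.
Proof. by apply/subsetP => k; rewrite mem_coowners => /andP[]. Qed.

(** Every remaining object points to a co-owner, so an agent leaves outside a cycle only when no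
    object remains. *)
Lemma stepP s : invariant s -> cur_order s != [::] -> step_spec s (step s).
Proof.
move=> inv; case s_eq: (cur_order s) => [//|i rest] _.
have arcP := updated_object_arc_coowner inv.
pose a := favorite E s i; pose aarc := updated_agent_arc s i a.
pose arc : rel I := fun k l => obind (oarc s) (aarc k) == Some l.
rewrite /Defs.step {1}s_eq /= -/a -/aarc -/arc.
have i_rem : i \in rem_agents s by rewrite inE s_eq mem_head.
case a_o: a => [o|]; last first.
  have rem0 : rem_objects s = set0 by exact: favorite_None a_o.
  apply: (@StepNull _ _ i) => //=.
    by apply/setP => o; rewrite !inE rem0 inE.
  apply/setP => k; rewrite !inE s_eq inE.
  have /andP[i_rest _] : uniq (i :: rest) by rewrite -s_eq inv_uniq.
  by case: eqP => [->|//]; rewrite (negPf i_rest).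
have o_rem : o \in rem_objects s by exact: favorite_rem a_o.
have [j o_j j_o] := arcP _ o_rem; rewrite /= o_j.
have j_rem : j \in rem_agents s := subsetP (coowners_rem s o) _ j_o.
have aarc_i : aarc i = Some o by rewrite /aarc /updated_agent_arc eqxx.
have ij : arc i j by rewrite /arc aarc_i /= o_j.
have aarc_rem k p : aarc k = Some p -> p \in rem_objects s.
  rewrite /aarc /updated_agent_arc; case: eqP => _; first exact: favorite_rem.
  by case: (agent_arc s k) => // q; case: ifP => // ? [<-].
have aarc_max k p b : aarc k = Some p -> b \in available s -> wpref E k (Some p) b.
  move=> k_p; have p_rem := aarc_rem _ _ k_p; move: k_p.
  rewrite /aarc /updated_agent_arc; case: eqP => [-> <-|_]; first exact: favorite_max.
  case k_q: (agent_arc s k) => [q|//]; case: ifP => // _ [q_p].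
  by rewrite q_p in k_q; exact: inv_agent_arc k_q p_rem.
case: ifPn => [ji|_]; last first.
  apply: StepMove => //=; apply/setP => k; rewrite !inE.
  have j_in : j \in cur_order s by move: j_rem; rewrite inE.
  by rewrite (perm_mem (perm_to_rem j_in)) inE.
(* Each agent has at most one arc, so the agents connected with [i] in both directions form a single
   cycle. *)
set K := [set k | connect arc i k && connect arc k i].
have arcE k l : arc k l -> exists2 p, aarc k = Some p & oarc s p = Some l.
  by rewrite /arc; case: (aarc k) => //= p /eqP; exists p.
have K_out k : k \in K -> exists2 l, l \in K & arc k l.
  rewrite inE => /andP[ik /connectP[[|l r] /= r_path i_eq]].
    by exists j; rewrite -?i_eq // inE ji connect1.
  case/andP: r_path => kl l_path; exists l => //; rewrite inE.
  apply/andP; split; first exact: connect_trans ik (connect1 kl).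
  by apply/connectP; exists r.
have K_in l : l \in K -> exists2 k, k \in K & arc k l.
  rewrite inE => /andP[il li].
  have /connectP[r] := connect_trans ji il.
  case/lastP: r => [_ /= l_j|r l']; first by exists i; rewrite ?inE ?connect0 // l_j.
  rewrite rcons_path last_rcons => /andP[r_path kl'] l_l'; rewrite -{l'}l_l' in kl'.
  exists (last j r) => //; rewrite inE (connect_trans (connect1 kl')) // andbT.
  by apply: connect_trans (connect1 ij) _; apply/connectP; exists r.
have K_rem : K \subset rem_agents s.
  apply/subsetP => l /K_in[k _ /arcE[p _]]; exact: updated_object_arc_rem.
have K_obj k : k \in K -> exists p l,
    [/\ aarc k = Some p, p \in rem_objects s, l \in K & l \in coowners s p].
  move=> /K_out[l lK /arcE[p k_p p_l]].
  have p_rem := aarc_rem _ _ k_p; exists p, l; split=> //.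
  by have [l'] := arcP _ p_rem; rewrite p_l => -[<-].
(* Counting: each agent of [K] is reached from [K] through an object, so [obind (oarc s)] maps the
   image of [K] under [aarc] onto a set containing a copy of [K]. *)
have aarc_inj : {in K &, injective aarc}.
  apply/imset_injP; rewrite eqn_leq leq_imset_card.
  rewrite -[X in X <= _](card_imset (mem K) (@Some_inj _)).
  apply: leq_trans (leq_imset_card (obind (oarc s)) _).
  apply/subset_leq_card/subsetP => _ /imsetP[l /K_in[k kK /eqP kl] ->].
  by rewrite -kl; do 2!apply: imset_f.
set B := [set p | _].
have inB p : (p \in B) = (Some p \in aarc @: K).
  rewrite inE; apply/exists_inP/imsetP => -[k kK].
    by move/eqP => k_p; exists k.
  by move=> k_p; exists k; rewrite ?k_p.
apply: (@StepCycle _ _ K aarc) => //=.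
- by apply/setP => p; rewrite !inE -inB inE andbC.
- by apply/setP => k; rewrite !inE mem_filter inE.
- move=> p l p_rem l_in; rewrite !mem_coowners l_in andbT /= p_rem.
  rewrite -!/(coowners _ _) in_setU [X in _ || (_ || X)]inE.
  have l_in' : l \in [seq k <- cur_order s | k \notin K] by rewrite inE in l_in.
  have l_rem : l \in rem_agents s.
    by move: l_in'; rewrite mem_filter => /andP[_ l_s]; rewrite inE.
  rewrite l_in' l_rem andbT mem_coowners l_rem andbT orbA /=; split.
    case/orP=> [->|/andP[_ /exists_inP[k kK /andP[k_p /exists_inP[b bB l_b]]]]]; first by left.
    have := bB; rewrite inE => /exists_inP[k' k'K /eqP k'_b].
    by right; exists k, k', b.
  case=> [-> //|[k [k' [b [kK k_p k'K k'_b l_b]]]]].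
  case: ((l \in owners E p) || _) => //=; apply/exists_inP; exists k; rewrite ?k_p //=.
  apply/exists_inP; exists b => //; rewrite inE.
  by apply/exists_inP; exists k'; rewrite ?k'_b.
- by move=> k b kK; have [p [l [k_p _ _ _]]] := K_obj _ kK; rewrite k_p; exact: aarc_max.
(* Follow arcs from [k] to [l]: each next agent co-owns the object that the previous one points to,
   hence lies in [A]. *)
move=> A A_closed k kK kA; apply/subsetP => l lK.
have: connect arc k l.
  move: kK lK; rewrite !inE => /andP[_ ki] /andP[il _]; exact: connect_trans ki il.
case/connectP => r; elim: r k kK kA => [|k' r IHr] k kK kA /=; first by move=> _ ->.
case/andP=> /arcE[p k_p p_k'] r_path l_r.
have [l' l'K /arcE[p']] := K_out _ kK; rewrite k_p => -[<-].
rewrite p_k' => -[k'_l']; rewrite -{l'}k'_l' in l'K.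
apply: (IHr k') => //; have [l' ] := arcP _ (aarc_rem _ _ k_p).
by rewrite p_k' => -[<-] /(subsetP (A_closed _ _ kK kA k_p)).
Qed.

Lemma step_arcs s (s' := step s) :
  [/\ forall k o, agent_arc s' k = Some o ->
        agent_arc s k = Some o \/ favorite E s k = Some o,
      forall o, object_arc s' o = object_arc s o \/ object_arc s' o = oarc s o,
      rem_objects s' \subset rem_objects s
    & forall o, shared s o \subset shared s' o].
Proof.
have aarcP i k o : updated_agent_arc s i (favorite E s i) k = Some o ->
    agent_arc s k = Some o \/ favorite E s k = Some o.
  rewrite /updated_agent_arc; case: eqP => [->|_]; first by right.
  by case: (agent_arc s k) => // p; case: ifP => // _ ->; left.
rewrite {}/s' /Defs.step; case: (cur_order s) => [|i rest].
  by split=> //; [left | left].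
case: (obind _ _) => [j|].
  case: ifP => _; split=> //=; try by [exact: aarcP | right].
    exact: subsetDl.
  by move=> o; case: ifP => _ //; exact: subsetUl.
split=> //=; try by [exact: aarcP | right].
by apply/subsetP => o; rewrite inE => /andP[].
Qed.

Lemma uniq_step s : uniq (cur_order s) -> uniq (cur_order (step s)).
Proof.
move=> s_uniq; rewrite /Defs.step; case s_eq: {1}(cur_order s) => [|i rest] //.
case: (obind _ _) => [j|]; last by move: s_uniq; rewrite s_eq => /andP[].
case: ifP => _; first exact: filter_uniq s_uniq.
by rewrite [cur_order _]/= cons_uniq rem_uniq // mem_rem_uniq // inE eqxx.
Qed.

Lemma invariant_step s : invariant s -> invariant (step s).
Proof.
move=> inv; have [aarcP oarcP objS shS] := step_arcs s.
have [s_nil|s_n] := eqVneq (cur_order s) [::].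
  by rewrite /Defs.step s_nil.
have st := stepP inv s_n.
have agS : rem_agents (step s) \subset rem_agents s.
  case: st => [i _ _ _ ->|_ -> _ _|K f _ ->] //; rewrite subsetDl //.
split.
- exact/uniq_step/inv_uniq.
- move=> k o b k_o o_rem b_av.
  have b_av' : b \in available s.
    by move: b_av; rewrite !inE; case: b => // p; exact: (subsetP objS).
  have [k_o'|<-] := aarcP _ _ k_o; last exact: favorite_max.
  exact: inv_agent_arc k_o' (subsetP objS _ o_rem) b_av'.
- move=> o o_rem; have o_rem' := subsetP objS _ o_rem.
  have cow j : j \in coowners s o -> j \in rem_agents (step s) ->
      j \in coowners (step s) o.
    rewrite !mem_coowners => /andP[/orP[->|/(subsetP (shS o)) ->] _] -> //.
    by rewrite orbT.
  have [->|->] := oarcP o.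
    have [j -> jE] := inv_object_arc inv o_rem'; exists j => // j_rem.
    exact: cow (jE (subsetP agS _ j_rem)) j_rem.
  by have [j ->] := updated_object_arc_coowner inv o_rem'; exists j => // ?; exact: cow.
- move=> k o; case: st => [i r0 -> _ -> ->|-> -> _ ->|K f -> -> -> _ K_rem _ _ _ _].
  + rewrite ffunE; case: eqP => // /eqP ki /(inv_outcome inv)[_ k_rem].
    by rewrite !inE ki in k_rem *.
  + exact: inv_outcome.
  rewrite ffunE !inE; case: ifP => [kK k_o|_ /(inv_outcome inv)[/negPf->]]; last by rewrite inE.
  by rewrite -k_o imset_f // andbF.
- move=> k l o; case: st => [i _ _ _ _ ->|_ _ _ ->|K f _ _ -> _ _ f_obj f_inj _ _].
  + by rewrite !ffunE; do 2!case: ifP => // _; exact: inv_outcome_inj.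
  + exact: inv_outcome_inj.
  (* An object traded in the current cycle was still remaining, so nobody held it before. *)
  have new m n : m \in K -> f m = Some o -> outcome s n = Some o -> m = n.
    move=> mK m_o /(inv_outcome inv)[]; have [p [q []]] := f_obj _ mK.
    by rewrite m_o => -[->] ->.
  rewrite !ffunE; case: ifP => kK; case: ifP => lK.
  + by move=> k_o l_o; apply: f_inj => //; rewrite k_o.
  + exact: new.
  + by move=> k_o l_o; rewrite (new l k).
  exact: inv_outcome_inj.
- move=> o k o_rem; have o_rem' := subsetP objS _ o_rem.
  case: st => [i r0|_ -> _ ->|K f _ -> -> _ _ f_obj _ _ _].
  + by rewrite r0 inE in o_rem'.
  + exact: inv_departed o_rem'.
  rewrite ffunE in_setD; case: ifP => [kK _|_].
    by have [p [l [->]]] := f_obj _ kK.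
  exact: inv_departed o_rem'.
move=> o o_rem; have o_rem' := subsetP objS _ o_rem.
(* Certificates are chosen for all objects at once, since those of the traded objects are needed
   along with that of [o]. *)
have /fin_all_exists[G clG] : forall p, exists G, p \in rem_objects s -> departed_closure s p G.
  move=> p; have [p_rem|_] := boolP (p \in rem_objects s); last by exists set0.
  by have [G clG] := inv_closure inv p_rem; exists G.
case: st => [i r0|_ agE shE outE|K f _ agE outE cowE K_rem f_obj _ _ _].
- by rewrite r0 inE in o_rem'.
- have cowE p : coowners (step s) p = coowners s p.
    by rewrite /coowners /rem_shared /rem_owners shE agE.
  have [G_dep oG G_cl] := clG _ o_rem'; exists (G o); split.
  + by rewrite agE.
  + by rewrite cowE.
  by move=> d p; rewrite outE cowE; exact: G_cl.
have sub p (H : {set I}) : p \in rem_objects s -> G p \subset H ->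
    (forall k, k \in K -> k \in coowners s p -> k \in H) ->
    (forall l, l \in rem_agents (step s) -> l \in coowners s p -> l \in coowners (step s) o) ->
    G p :|: coowners s p \subset H :|: coowners (step s) o.
  move=> p_rem GH KH cow; apply/subsetP => k; rewrite in_setU in_setU.
  case/orP=> [/(subsetP GH)-> //|k_p].
  have [/KH-> //|kK] := boolP (k \in K).
  by rewrite cow ?orbT // agE inE kK (subsetP (coowners_rem s p)).
have G_old p d : p \in rem_objects s -> d \in G p -> d \notin rem_agents s.
  by case/clG=> /pred0P/(_ d)/= + _ _ dG; rewrite dG /= => ->.
have out_old d : d \notin rem_agents s -> outcome (step s) d = outcome s d.
  by rewrite outE ffunE; case: ifP => // /(subsetP K_rem)->.
(* If no agent of [K] co-owns [o], every co-owner of [o] stays and the old certificate remains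
   valid. *)
have [/exists_inP[k0 k0K k0_o]|noK] := boolP [exists k0 in K, k0 \in coowners s o]; last first.
  have cow l : l \in rem_agents (step s) -> l \in coowners s o -> l \in coowners (step s) o.
    by move=> l_rem l_o; apply/cowE; [|  |left].
  have sub_o := sub _ _ o_rem' (subxx _) _ cow.
  have {}sub_o : G o :|: coowners s o \subset G o :|: coowners (step s) o.
    by apply: sub_o => k kK k_o; case/exists_inP: noK; exists k.
  have [G_dep oG G_cl] := clG _ o_rem'; exists (G o); split.
  + by apply: disjointWr G_dep; exact: agS.
  + exact: subset_trans oG sub_o.
  by move=> d p dG; rewrite (out_old _ (G_old _ _ o_rem' dG)) => /(G_cl _ _ dG)/subset_trans; apply.
(* Otherwise the certificate absorbs [K] and the certificates of the traded objects. Remaining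
   co-owners of those objects have become co-owners of [o] through [k0]. *)
pose cyc p := (p \in rem_objects s) && ((p == o) || [exists k in K, f k == Some p]).
pose H := K :|: \bigcup_(p | cyc p) G p.
have sub_cyc p : cyc p -> G p :|: coowners s p \subset H :|: coowners (step s) o.
  move=> p_cyc; have /andP[p_rem p_K] := p_cyc; apply: sub => //.
  + by apply: subset_trans (subsetUr _ _); exact: bigcup_sup.
  + by move=> k kK _; rewrite inE kK.
  move=> l l_rem l_p; apply/cowE => //.
  case/orP: p_K => [/eqP p_o|/exists_inP[k' k'K /eqP k'_p]]; first by left; rewrite -p_o.
  by right; exists k0, k', p.
have o_cyc : cyc o by rewrite /cyc o_rem' eqxx.
exists H; split.
- apply/pred0P => k /=; apply/negP => /andP[]; rewrite agE in_setU in_setD.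
  case: (k \in K) => //= /bigcupP[p /andP[p_rem _] kG].
  by rewrite (negPf (G_old _ _ p_rem kG)).
- by have [_ oG _] := clG _ o_rem'; apply: subset_trans oG (sub_cyc _ o_cyc).
move=> d p; rewrite in_setU => /orP[dK|/bigcupP[q q_cyc dG]].
  rewrite outE ffunE dK => d_p; have [p' [l []]] := f_obj _ dK.
  rewrite d_p => -[<-] p_rem _ _.
  have p_cyc : cyc p.
    by rewrite /cyc p_rem; apply/orP; right; apply/exists_inP; exists d; rewrite ?d_p.
  by have [_ pG _] := clG _ p_rem; apply: subset_trans pG (sub_cyc _ p_cyc).
have /andP[q_rem _] := q_cyc; have [_ _ G_cl] := clG _ q_rem.
by rewrite (out_old _ (G_old _ _ q_rem dG)) => /(G_cl _ _ dG)/subset_trans; apply; exact: sub_cyc.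
Qed.

(** * A candidate weak block of the outcome, followed along the run *)

Section CoreInvariant.
Variables (mu sigma : {ffun I -> option O}) (C : {set I}).
Hypotheses (sigma_al : allocation sigma) (C_self : self_enforcing E sigma C).
Hypothesis sigma_mu : forall i, i \in C -> wpref E i (sigma i) (mu i).

Definition agrees_with_outcome s : Prop :=
  forall k, k \notin rem_agents s -> outcome s k = mu k.

(** Here [mu] stands for the final outcome. [inv_taken] says that objects of the endowments of [C]
    leave only with members of [C], so what [sigma] promises to a remaining member is still
    available. *)
Record coalition_invariant s : Prop := CoalitionInvariant {
  inv_assigned : forall k, k \in C -> k \notin rem_agents s -> sigma k = mu k;
  inv_coowners : forall o, o \in rem_objects s -> owners E o \subset C ->
    coowners s o \subset C;
  inv_taken : forall o, o \notin rem_objects s -> owners E o \subset C ->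
    exists k, [/\ k \in C, k \notin rem_agents s & mu k = Some o]
}.

Lemma coalition_invariant_init : coalition_invariant (init E rank).
Proof.
split=> [k _|o _ oC|o]; rewrite ?mem_rem_init ?inE //.
apply/subsetP => k; rewrite mem_coowners !inE orbF => /andP[+ _].
exact: (subsetP oC).
Qed.

(** Assignments of departed agents never change, so agreement with the final outcome propagates
    backwards. *)
Lemma agrees_with_outcome_step s :
  invariant s -> agrees_with_outcome (step s) -> agrees_with_outcome s.
Proof.
move=> inv ag k k_rem; rewrite -ag.
  have [s_nil|s_n] := eqVneq (cur_order s) [::]; first by rewrite /Defs.step s_nil.
  case: (stepP inv s_n) => [i _ _ i_rem _ ->|_ _ _ -> //|K f _ _ -> _ K_rem _ _ _ _].
    by rewrite ffunE; case: eqP => // ki; rewrite ki i_rem in k_rem.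
  by rewrite ffunE; case: ifP k_rem => // /(subsetP K_rem)->.
have [s_nil|s_n] := eqVneq (cur_order s) [::]; first by rewrite /Defs.step s_nil.
case: (stepP inv s_n) => [i _ _ _ -> _|_ -> //|K f _ -> _ _ _ _ _ _ _].
  by rewrite in_setD1 (negPf k_rem) andbF.
by rewrite in_setD (negPf k_rem) andbF.
Qed.

Lemma coalition_invariant_step s :
    invariant s -> agrees_with_outcome (step s) ->
  coalition_invariant s -> coalition_invariant (step s).
Proof.
move=> inv ag cinv; have [s_nil|s_n] := eqVneq (cur_order s) [::].
  by rewrite /Defs.step s_nil.
have s_inj := (allocationP _).1 sigma_al.
have sP k o : k \in C -> sigma k = Some o -> owners E o \subset C.
  by move=> kC; exact: (self_enforcingP E sigma C C_self).
(* Were [o] gone, a departed member of [C] would hold it under [mu], hence under [sigma],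
   contradicting that [sigma] is an allocation. *)
have s_rem k o : k \in C -> k \in rem_agents s -> sigma k = Some o -> o \in rem_objects s.
  move=> kC k_rem k_o; apply: contraLR k_rem => /(inv_taken cinv)/(_ (sP _ _ kC k_o)).
  case=> l [lC l_rem l_o]; rewrite (s_inj k l o) //.
  by rewrite (inv_assigned cinv).
case: (stepP inv s_n) => [i r0 r0' i_rem agE outE|objE agE shE outE|].
- split.
  + move=> k kC k_rem; have [ki|/eqP ki] := eqVneq k i; last first.
      by apply: (inv_assigned cinv) => //; move: k_rem; rewrite agE in_setD1; case: eqP.
    rewrite -ag // outE ffunE ki eqxx; case k_o: (sigma i) => [o|//].
    rewrite ki in kC; have := s_rem _ _ kC i_rem k_o.
    by rewrite r0 inE.
  + by move=> o; rewrite r0' inE.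
  move=> o _ oC; have [|k [kC k_rem k_o]] := inv_taken cinv _ oC; first by rewrite r0 inE.
  by exists k; rewrite agE in_setD1 negb_and k_rem orbT.
- split; rewrite ?objE ?agE; try by case: cinv.
  by rewrite /coowners /rem_shared /rem_owners shE agE; case: cinv.
move=> K f objE agE outE cowE K_rem f_obj f_inj f_max K_conn.
(* [f k] is the best remaining choice and [sigma k] still remains, while [sigma k] is weakly better
   than [mu k = f k]; antisymmetry gives equality. *)
have fE k : k \in K -> k \in C -> f k = sigma k.
  move=> kK kC; have k_mu : f k = mu k.
    by rewrite -ag ?outE ?ffunE ?kK // agE in_setD kK.
  apply: (@wpref_anti _ _ E k); rewrite {2}k_mu sigma_mu // andbT.
  apply: f_max => //; rewrite inE; case k_o: (sigma k) => [o|//].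
  exact: s_rem kC (subsetP K_rem _ kK) k_o.
(* A member of [C] in the cycle points to its [sigma] object, whose owners and hence co-owners lie
   in [C], so the cycle cannot leave [C]. *)
have cycle_in k : k \in K -> k \in C -> K \subset C.
  apply: K_conn => {}k o kK kC k_o; have [p [l [k_p p_rem _ _]]] := f_obj _ kK.
  move: k_p; rewrite k_o => -[o_p]; rewrite -{p}o_p in p_rem.
  by apply: (inv_coowners cinv) => //; rewrite (sP k) // -fE.
split.
- move=> k kC k_rem; have [kK|kK] := boolP (k \in K).
    by rewrite -fE // -ag // outE ffunE kK.
  by apply: (inv_assigned cinv) => //; move: k_rem; rewrite agE in_setD kK.
- move=> o o_rem oC; have o_rem' : o \in rem_objects s.
    by move: o_rem; rewrite objE inE => /andP[].
  have o_cow := subsetP (inv_coowners cinv o_rem' oC).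
  apply/subsetP => l l_o; have l_rem := subsetP (coowners_rem _ _) _ l_o.
  have [/o_cow //|[k [k' [p [kK k_o k'K k'_p l_p]]]]] := (cowE _ _ o_rem l_rem).1 l_o.
  have k'C : k' \in C := subsetP (cycle_in _ kK (o_cow _ k_o)) _ k'K.
  have [q [? [k'_q q_rem _ _]]] := f_obj _ k'K.
  move: k'_q; rewrite k'_p => -[p_q]; rewrite -{q}p_q in q_rem.
  by apply: (subsetP (inv_coowners cinv q_rem _)) l_p; rewrite (sP k') // -fE.
move=> o; rewrite objE inE negb_and negbK.
have [o_rem /= /imsetP[k kK o_k] oC|o_rem _ oC] := boolP (o \in rem_objects s).
  exists k; have [p [l [k_p _ lK l_p]]] := f_obj _ kK.
  move: k_p; rewrite -o_k => -[o_p]; rewrite -{p}o_p in l_p.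
  have lC := subsetP (inv_coowners cinv o_rem oC) _ l_p.
  split; first exact: (subsetP (cycle_in _ lK lC)).
    by rewrite agE in_setD kK.
  by rewrite -ag ?outE ?ffunE ?kK // agE in_setD kK.
have [k [kC k_rem k_o]] := inv_taken cinv o_rem oC.
by exists k; rewrite agE in_setD (negPf k_rem) andbF.
Qed.

End CoreInvariant.

Lemma invariant_iter t : invariant (iter t step (init E rank)).
Proof. by elim: t => [|t IHt]; [exact: invariant_init | exact: invariant_step]. Qed.

Lemma outcome_strong_core t :
    cur_order (iter t step (init E rank)) = [::] ->
  strong_core E (outcome (iter t step (init E rank))).
Proof.
set s_ := fun t => iter t step (init E rank) => t_end.
have inv := invariant_iter t; split.
  by apply/allocationP; exact: inv_outcome_inj.
case=> C [sigma [_ s_al _ [s_wk [j jC j_pref]] C_self]].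
pose mu := outcome (s_ t).
(* Induction on the number [v] of steps left before the end of the run. *)
have ag v u : u + v = t -> agrees_with_outcome mu (s_ u).
  elim: v u => [|v IHv] u; first by rewrite addn0 => ->.
  rewrite addnS -addSn => /IHv; exact/agrees_with_outcome_step/invariant_iter.
have cinv u : u <= t -> coalition_invariant mu sigma C (s_ u).
  elim: u => [_|u IHu ut]; first exact: coalition_invariant_init.
  apply: coalition_invariant_step => //; first exact: invariant_iter.
    exact: ag (subnKC ut).
  exact/IHu/ltnW.
move: j_pref; rewrite (inv_assigned (cinv _ (leqnn t)) jC) ?prefxx //.
by rewrite inE t_end.
Qed.

End Algorithm.

(** * Economies given by numerical scores, and comparison of the exclusion notions *)

Section ScoreEconomy.
Variables (I O : finType) (score : I -> option O -> nat) (own : O -> {set I}).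
Hypotheses (score_inj : forall i, injective (score i)).
Hypotheses (own_neq0 : forall o, own o != set0).

Lemma score_linear i : strict_linear_order (fun a b => score i b < score i a).
Proof.
split=> [a|b a c ba cb|a b ab]; first exact: ltnn.
  exact: ltn_trans cb ba.
by rewrite -neq_ltn eq_sym; apply/eqP => /score_inj.
Qed.

Definition score_economy : economy I O := Economy score_linear own_neq0.

Lemma score_wpref i a b : wpref score_economy i a b = (score i b <= score i a).
Proof. by rewrite /wpref /= [RHS]leq_eqVlt (inj_eq (@score_inj i)) eq_sym. Qed.

(** The map [f] picks distinct owners for distinct objects, so it embeds the endowments of [C] into
    [C]. *)
Lemma representatives_no_redundant (f : O -> I) :
    (forall i, score i None = 0) -> injective f -> (forall o, f o \in own o) ->
  no_redundant_ownership score_economy.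
Proof.
move=> score0 f_inj f_own; split=> [i o|C _] /=.
  by rewrite score0 lt0n; apply/eqP; rewrite -(score0 i) => /score_inj.
pose D := [set o | own o \subset C].
have -> : endow score_economy C = Some @: D.
  apply/setP => -[o|]; rewrite inE.
    by rewrite mem_imset ?inE //; exact: Some_inj.
  by apply/esym/imsetP => -[].
rewrite (card_imset _ (@Some_inj _)) -(card_imset _ f_inj).
apply/subset_leq_card/subsetP => _ /imsetP[o + ->].
by rewrite inE => /subsetP; apply.
Qed.

End ScoreEconomy.

(** When all members improve strictly, the agreement set is empty and condition (3) holds
    vacuously. *)
Lemma exclusion_blocked_refined (I O : finType) (E : economy I O)
    (mu sigma : {ffun I -> option O}) (C : {set I}) :
  exclusion_blocked E mu C sigma -> refined_exclusion_blocked E mu C sigma.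
Proof.
case=> C0 s_al s_mu s_pref s_hurt; split=> //.
  split=> [i iC|]; first by rewrite /wpref s_pref ?orbT.
  by have [i iC] := set0Pn _ C0; exists i; rewrite ?s_pref.
case; apply/setP => i; rewrite !inE; apply/negP => /andP[iC /eqP i_mu].
by have := s_pref _ iC; rewrite i_mu prefxx.
Qed.

Lemma refined_exclusion_core_exclusion (I O : finType) (E : economy I O)
    (mu : {ffun I -> option O}) :
  refined_exclusion_core E mu -> exclusion_core E mu.
Proof.
case=> mu_al nbl; split=> // -[C [sigma bl]]; apply: nbl.
by exists C, sigma; exact: exclusion_blocked_refined.
Qed.

(** If [C] has no endowments, nobody holds one, so the chain of dependents never grows beyond
    [C]. *)
Lemma endow0_not_extended (I O : finType) (E : economy I O)
    (mu : {ffun I -> option O}) (C : {set I}) a :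
  endow E C = set0 -> ~ extended_endow E mu C a.
Proof.
move=> C0; have dep k : dependents E mu C k = C.
  elim: k => //= k ->; apply/setP => i; rewrite !inE.
  by move/setP/(_ (mu i)): C0; rewrite inE in_set0 => ->; rewrite orbF.
case: a => [o|] //= o_ext; have := in_set0 (Some o); rewrite -C0 mem_endow.
move=> /negP[]; apply/subsetP => i /o_ext[k]; by rewrite dep.
Qed.

(** * A strong core allocation outside the exclusion core *)

Definition o30 : 'I_3 := @Ordinal 3 0 isT.
Definition o31 : 'I_3 := @Ordinal 3 1 isT.
Definition o32 : 'I_3 := @Ordinal 3 2 isT.

Lemma ord3P (i : 'I_3) : [\/ i = o30, i = o31 | i = o32].
Proof.
case: i => [[|[|[|m]]] p] //; [apply: Or31|apply: Or32|apply: Or33]; exact: val_inj.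
Qed.

(* Agents 1 and 2 can exclude agent 0 from object 1, which agent 1 owns, and then
   both improve; but agent 1 improves only through object 2, owned by everybody
   including agent 0, so no weakly blocking coalition spares agent 0. *)
Definition scoreA (i : 'I_3) (x : option 'I_3) : nat :=
  if x is Some o then
    nth 0 (nth [::] [:: [:: 1; 3; 2]; [:: 2; 1; 3]; [:: 1; 3; 2]] i) o
  else 0.

Definition ownA (o : 'I_3) : {set 'I_3} :=
  [set i | i \in nth [::] [:: [:: o30]; [:: o31]; [:: o30; o31; o32]] o].

Lemma scoreA_inj i : injective (scoreA i).
Proof.
move=> [o|] [p|]; [case: (ord3P o) => ->; case: (ord3P p) => ->
  |case: (ord3P o) => ->|case: (ord3P p) => ->|]; by case: (ord3P i) => ->.
Qed.

Lemma ownA_self o : o \in ownA o.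
Proof. by rewrite inE; case: (ord3P o) => ->; rewrite !inE eqxx ?orbT. Qed.

Lemma ownA_neq0 o : ownA o != set0.
Proof. by apply/set0Pn; exists o; exact: ownA_self. Qed.

Definition economyA := score_economy scoreA_inj ownA_neq0.

Definition muA : {ffun 'I_3 -> option 'I_3} :=
  [ffun i => Some (nth o30 [:: o31; o30; o32] (nat_of_ord i))].
Definition sigmaA : {ffun 'I_3 -> option 'I_3} :=
  [ffun i => Some (nth o30 [:: o30; o32; o31] (nat_of_ord i))].

Lemma economyA_no_redundant : no_redundant_ownership economyA.
Proof.
by apply: (@representatives_no_redundant _ _ _ _ _ _ id) => // o; exact: ownA_self.
Qed.

Lemma muA_strong_core : strong_core economyA muA.
Proof.
split.
  apply/allocationP => i j o; rewrite !ffunE.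
  by case: (ord3P i) => ->; case: (ord3P j) => -> // <-.
case=> C [sigma [_ /allocationP s_inj _ [s_wk [j jC j_pref]] C_self]].
have sP i o : i \in C -> sigma i = Some o -> ownA o \subset C.
  by move=> iC; exact: (self_enforcingP economyA sigma C C_self).
have wk i : i \in C -> scoreA i (muA i) <= scoreA i (sigma i).
  by move=> /s_wk; rewrite score_wpref.
(* Agent 0 holds her favorite object under [muA] and must keep it. *)
have s0 : o30 \in C -> sigma o30 = Some o31.
  by move=> /wk; rewrite ffunE; case: (sigma o30) => // o; case: (ord3P o) => ->.
(* Agent 1 accepts only objects 0 and 2, and agent 0 is among the owners of both. *)
have s1 : o31 \in C -> o30 \in C.
  move=> C1; have := wk _ C1; rewrite ffunE; case s_o: (sigma o31) => [o|//].
  have := sP _ _ C1 s_o; case: (ord3P o) => -> // /subsetP sub _; apply: sub.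
    exact: ownA_self.
  by rewrite inE !inE.
have s2 : o32 \in C -> sigma o32 = Some o32 \/ sigma o32 = Some o31.
  move=> /wk; rewrite ffunE; case: (sigma o32) => // o.
  by case: (ord3P o) => -> // _; [right|left].
have no2 : o32 \in C -> sigma o32 <> Some o31.
  move=> C2 s_31; have /s1/s0 s_30 : o31 \in C.
    by apply: (subsetP (sP _ _ C2 s_31)); exact: ownA_self.
  by have := s_inj _ _ _ s_30 s_31.
move: j_pref; rewrite /= ffunE; case: (ord3P j) jC => ->.
- by case: (sigma o30) => // o; case: (ord3P o) => ->.
- move=> C1; case s_o: (sigma o31) => [o|//].
  case: (ord3P o) s_o => -> // s_o _.
  have C2 : o32 \in C by apply: (subsetP (sP _ _ C1 s_o)); exact: ownA_self.
  case: (s2 C2) => [s_32|/(no2 C2) //].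
  by have := s_inj _ _ _ s_o s_32.
move=> C2; case: (s2 C2) => [->//|/(no2 C2) //].
Qed.

Lemma muA_exclusion_blocked : exclusion_blocked economyA muA [set o31; o32] sigmaA.
Proof.
split.
- by apply/set0Pn; exists o31; rewrite !inE.
- apply/allocationP => i j o; rewrite !ffunE.
  by case: (ord3P i) => ->; case: (ord3P j) => -> // <-.
- by move=> /ffunP/(_ o30); rewrite !ffunE.
- by move=> i; rewrite !inE => /orP[] /eqP->; rewrite /= !ffunE.
move=> j; rewrite !ffunE; case: (ord3P j) => -> //= _ i.
by rewrite inE /= inE => /eqP->; exists 0; rewrite !inE.
Qed.

(** * A refined exclusion core allocation outside the strong core *)

Definition o40 : 'I_4 := @Ordinal 4 0 isT.
Definition o41 : 'I_4 := @Ordinal 4 1 isT.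
Definition o42 : 'I_4 := @Ordinal 4 2 isT.
Definition o43 : 'I_4 := @Ordinal 4 3 isT.

Lemma ord4P (i : 'I_4) : [\/ i = o40, i = o41, i = o42 | i = o43].
Proof.
case: i => [[|[|[|[|m]]]] p] //;
  [apply: Or41|apply: Or42|apply: Or43|apply: Or44]; exact: val_inj.
Qed.

(* Agent 3 holds object [false] of agent 0, who could hand it to agent 1 or 2.
   Agent 0 is indifferent, holding [true], which is owned by all of 0, 1, 2; so
   the agents whose assignment is unchanged are not self-enforcing, while
   whichever of 1 and 2 gets nothing is self-enforcing alone. *)
Definition scoreB (i : 'I_4) (x : option bool) : nat := if x is Some o then o.+1 else 0.

Definition ownB (o : bool) : {set 'I_4} := if o then ~: [set o43] else [set o40].

Lemma scoreB_inj i : injective (scoreB i).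
Proof. by case=> [[]|] [[]|]. Qed.

Lemma ownB_o40 o : o40 \in ownB o.
Proof. by case: o; rewrite !inE. Qed.

Lemma ownB_neq0 o : ownB o != set0.
Proof. by apply/set0Pn; exists o40; exact: ownB_o40. Qed.

Definition economyB := score_economy scoreB_inj ownB_neq0.

Definition muB : {ffun 'I_4 -> option bool} :=
  [ffun i : 'I_4 => nth None [:: Some true; None; None; Some false] i].
(** Agents 2 and 3 lie beyond the list and get the default [None]. *)
Definition sigmaB : {ffun 'I_4 -> option bool} :=
  [ffun i : 'I_4 => nth None [:: Some true; Some false] i].

Lemma economyB_no_redundant : no_redundant_ownership economyB.
Proof.
apply: (@representatives_no_redundant _ _ _ _ _ _ (fun o => if o then o41 else o40)) => //.
  by case=> -[].
by case; rewrite !inE.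
Qed.

Lemma muB_weakly_blocked : weakly_blocked economyB muB (~: [set o43]) sigmaB.
Proof.
split.
- by apply/set0Pn; exists o40; rewrite !inE.
- apply/allocationP => i j o; rewrite !ffunE.
  by case: (ord4P i) => ->; case: (ord4P j) => -> // <-.
- by move=> /ffunP/(_ o43); rewrite !ffunE.
- split=> [i|]; last by exists o41; rewrite ?inE //= !ffunE.
  by rewrite !inE score_wpref !ffunE; case: (ord4P i) => ->.
apply/self_enforcingP => i o _; rewrite ffunE => i_o; rewrite /= /ownB.
by case: o i_o => // _; apply/subsetP => k; rewrite !inE => /eqP->.
Qed.

Lemma muB_refined_exclusion_core : refined_exclusion_core economyB muB.
Proof.
split.
  apply/allocationP => i j o; rewrite !ffunE.
  by case: (ord4P i) => ->; case: (ord4P j) => -> // <-.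
case=> C [sigma [[_ /allocationP s_inj _] [s_wk [j jC j_pref]] s_hurt s_agree]].
have wk i : i \in C -> scoreB i (muB i) <= scoreB i (sigma i).
  by move=> /s_wk; rewrite score_wpref.
(* Agent 0 co-owns every object, so a coalition without her has no endowments and may hurt
   nobody. *)
have hurt : o40 \notin C -> forall i, scoreB i (muB i) <= scoreB i (sigma i).
  move=> C0 i; rewrite leqNgt; apply/negP => /s_hurt; apply: endow0_not_extended.
  apply/setP => -[o|]; rewrite !inE //.
  by apply: contraNF C0 => /subsetP; apply; exact: ownB_o40.
have s0 : sigma o40 = Some true.
  have: scoreB o40 (muB o40) <= scoreB o40 (sigma o40).
    by have [/wk|/hurt] := boolP (o40 \in C).
  by rewrite ffunE; case: (sigma o40) => // -[].
have no_true i : i != o40 -> sigma i <> Some true.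
  by move=> /eqP i0 /s_inj /(_ s0).
(* Agent 0 keeps [true], so the improving agent can only move from nothing to [false]. *)
have sj : sigma j = Some false /\ muB j = None.
  move: j_pref; have := no_true j; rewrite /= ffunE; case s_j: (sigma j) => [[]|//].
    by case: (ord4P j) s_j => -> // s_j /(_ isT)[].
  by case: (ord4P j) => ->.
case: sj => sj muj.
have no_false i : i != j -> sigma i <> Some false by move=> /eqP ij /s_inj /(_ sj).
(* Agent 3 loses [false] to [j] and is hurt, which requires agent 0 in [C]. *)
have C0 : o40 \in C.
  apply: contraT => /hurt/(_ o43).
  have : o43 != j by apply: contraPneq muj => <-; rewrite ffunE.
  move=> /no_false; have := no_true o43 isT; rewrite ffunE.
  by case: (sigma o43) => [[]|].
(* Of agents 1 and 2, [k] is the one other than [j]. *)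
have [k [kj k0 k_own]] : exists k, [/\ k != j, k != o40 & k \in ownB true].
  by move: muj; rewrite ffunE; case: (ord4P j) => -> // _; [exists o42|exists o41]; rewrite !inE.
have s_k : sigma k = None.
  by have := no_true _ k0; have := no_false _ kj; case: (sigma k) => [[]|].
have j_own : j \in ownB true.
  by move: muj; rewrite ffunE; case: (ord4P j) => -> // _; rewrite !inE.
have ag0 : o40 \in agree C sigma muB by rewrite inE C0 s0 ffunE eqxx.
(* In case (a), agent 0 holding [true] forces [j] into the agreement set, although [j] changed
   assignment. In case (b), it forces [k] into [C], and [[set k]] is a smaller self-enforcing
   coalition. *)
case: s_agree; first by move=> ag; rewrite ag inE in ag0.
  case=> /self_enforcingP ag_self _.
  have /subsetP/(_ _ j_own) := ag_self _ _ ag0 s0.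
  by rewrite inE sj muj andbF.
case=> /self_enforcingP C_self C_min; have kC := subsetP (C_self _ _ C0 s0) _ k_own.
apply: (C_min [set k]).
- by apply/set0Pn; exists k; rewrite inE.
- apply/properP; split; first by rewrite sub1set.
  by exists o40; rewrite // inE eq_sym.
by apply/self_enforcingP => i o; rewrite inE => /eqP->; rewrite s_k.
Qed.

Theorem proposition1 :
  (forall (I O : finType) (E : economy I O),
     no_redundant_ownership E ->
     (forall mu : {ffun I -> option O},
        yrmh_igyt_outcome E mu -> strong_core E mu) /\
     (forall mu : {ffun I -> option O},
        strong_core E mu <-> rectified_core E mu)) /\
  [/\ exists (I O : finType) (E : economy I O),
        no_redundant_ownership E /\
        ~ (forall mu : {ffun I -> option O},
             strong_core E mu -> exclusion_core E mu),
      exists (I O : finType) (E : economy I O),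
        no_redundant_ownership E /\
        ~ (forall mu : {ffun I -> option O},
             strong_core E mu -> refined_exclusion_core E mu),
      exists (I O : finType) (E : economy I O),
        no_redundant_ownership E /\
        ~ (forall mu : {ffun I -> option O},
             exclusion_core E mu -> strong_core E mu)
    & exists (I O : finType) (E : economy I O),
        no_redundant_ownership E /\
        ~ (forall mu : {ffun I -> option O},
             refined_exclusion_core E mu -> strong_core E mu)].
Proof.
have nexA : ~ exclusion_core economyA muA.
  by case=> _; apply; exists [set o31; o32], sigmaA; exact: muA_exclusion_blocked.
have nstB : ~ strong_core economyB muB.
  by case=> _; apply; exists (~: [set o43]), sigmaB; exact: muB_weakly_blocked.
split=> [I O E nro|].
  split=> mu; last exact: strong_core_rectified.
  by case=> rank rank_linear [t [t_end ->]]; exact: outcome_strong_core.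
split.
- exists 'I_3, 'I_3, economyA; split; first exact: economyA_no_redundant.
  by move/(_ muA muA_strong_core).
- exists 'I_3, 'I_3, economyA; split; first exact: economyA_no_redundant.
  by move/(_ muA muA_strong_core)/refined_exclusion_core_exclusion.
- exists 'I_4, bool, economyB; split; first exact: economyB_no_redundant.
  by move/(_ muB (refined_exclusion_core_exclusion muB_refined_exclusion_core)).
exists 'I_4, bool, economyB; split; first exact: economyB_no_redundant.
by move/(_ muB muB_refined_exclusion_core).
Qed.
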